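(* For every pair of integers $k \ge 1$ and $\ell \ge 2$, we have $\chi'_{st}(C_{4k} \,\square\, C_{2\ell}) = 6$.
   Context: A star edge-coloring of a graph $G$ is a proper edge-coloring of $G$ in which there is no bichromatic path and no bichromatic cycle of length four (i.e., with four edges). The star chromatic index $\chi'_{st}(G)$ is the minimum number of colors in a star edge-coloring of $G$. $C_m$ denotes the cycle on $m$ vertices. $G \,\square\, H$ denotes the Cartesian product: vertex set $V(G)\times V(H)$, with $(u,v)(u',v')$ an edge iff either $uu'\in E(G)$ and $v=v'$, or $u=u'$ and $vv'\in E(H)$. *)

(* Defs.v *)
From mathcomp Require Import all_boot.

Set Implicit Arguments.
Unset Strict Implicit.
Unset Printing Implicit Defensive.

Record sgraph := SGraph {
  vert : finType;
  adj : rel vert;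
  adj_sym : symmetric adj;
  adj_irrefl : irreflexive adj }.

Definition edge_set (G : sgraph) : {set {set vert G}} :=
  [set [set u; v] | u in [set: vert G], v in [set w | adj u w]].

Definition edge (G : sgraph) := {e : {set vert G} | e \in edge_set G}.

Definition path_edges (T : finType) (x : T) (p : seq T) : seq {set T} :=
  pairmap (fun u v => [set u; v]) x p.

Definition cycle_edges (T : finType) (s : seq T) : seq {set T} :=
  if s is x :: p then path_edges x (rcons p x) else [::].

Section EdgeColoring.
Variables (G : sgraph) (C : finType) (c : edge G -> C).

Definition proper_edge_coloring : bool :=
  [forall e : edge G, forall f : edge G,
     (e != f) && ~~ [disjoint val e & val f] ==> (c e != c f)].

Definition bichromatic (s : seq {set vert G}) : bool :=
  #|[set c e | e in [set e : edge G | val e \in s]]| == 2.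

Definition star_edge_coloring : bool :=
  [&& proper_edge_coloring,
      [forall x : vert G, forall p : 4.-tuple (vert G),
         path (@adj G) x p && uniq (x :: p) ==> ~~ bichromatic (path_edges x p)]
    & [forall s : 4.-tuple (vert G),
         cycle (@adj G) s && uniq s ==> ~~ bichromatic (cycle_edges s)]].

End EdgeColoring.

Definition star_edge_colorable (G : sgraph) (q : nat) : bool :=
  [exists c : {ffun edge G -> 'I_q}, star_edge_coloring c].

Lemma edge_setP (G : sgraph) (u v : vert G) :
  adj u v -> [set u; v] \in edge_set G.
Proof. by move=> uv; apply/imset2P; exists u v; rewrite ?inE. Qed.

Lemma inj_not_bichromatic (G : sgraph) (C : finType) (c : edge G -> C)
    (s : seq {set vert G}) (x y z t : vert G) :
    injective c -> adj x y -> adj y z -> adj z t -> uniq [:: x; y; z; t] ->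
    {subset [:: [set x; y]; [set y; z]; [set z; t]] <= s} ->
  ~~ bichromatic c s.
Proof.
move=> c_inj xy yz zt; rewrite /= !inE !negb_or.
case/and4P=> /and3P[nxy nxz nxt] /andP[nyz nyt] nzt _ sub.
rewrite /bichromatic card_imset // neq_ltn; apply/orP; right.
pose e1 : edge G := exist (fun e => e \in edge_set G) _ (edge_setP xy).
pose e2 : edge G := exist (fun e => e \in edge_set G) _ (edge_setP yz).
pose e3 : edge G := exist (fun e => e \in edge_set G) _ (edge_setP zt).
apply/card_gt2P; exists e1, e2, e3; split.
- by split; rewrite inE /=; apply: sub; rewrite !inE eqxx ?orbT.
- have neq (a b : edge G) w : w \in val a -> w \notin val b -> a != b.
    by move=> wa; apply: contraNneq => <-.
  split.
  + by apply: (neq _ _ x); rewrite /= !inE ?eqxx // negb_or nxy.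
  + by apply: (neq _ _ y); rewrite /= !inE ?eqxx // negb_or nyz.
  + by apply: (neq _ _ t);
      rewrite /= !inE ?eqxx ?orbT // negb_or ![t == _]eq_sym nxt.
Qed.

Lemma star_edge_colorable_ex (G : sgraph) : exists q, star_edge_colorable G q.
Proof.
exists #|{: edge G}|; apply/existsP; exists [ffun e => enum_rank e].
set c := (X in star_edge_coloring X).
have c_inj : injective c by move=> e f; rewrite /c !ffunE => /enum_rank_inj.
apply/and3P; split.
- apply/forallP=> e; apply/forallP=> f; apply/implyP=> /andP[nef _].
  by rewrite (inj_eq c_inj).
- apply/forallP=> x; apply/forallP=> -[[|a [|b [|d [|f []]]]] //= szp].
  apply/implyP=> /andP[/and5P[xa ab bd df _] U].
  apply: (inj_not_bichromatic c_inj xa ab bd).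
    have : uniq ([:: x; a; b; d] ++ [:: f]) by exact: U.
    by rewrite cat_uniq => /andP[].
  by move=> g; rewrite !inE => /or3P[] ->; rewrite ?orbT.
- apply/forallP=> -[[|a [|b [|d [|f []]]]] //= szp].
  apply/implyP=> /andP[/and5P[ab bd df _ _] U].
  apply: (inj_not_bichromatic c_inj ab bd df U).
  by move=> g; rewrite !inE => /or3P[] ->; rewrite ?orbT.
Qed.

Definition star_chromatic_index (G : sgraph) : nat :=
  ex_minn (star_edge_colorable_ex G).

(* This is the cycle graph only for m >= 3 (for m = 2 it is a single edge). The
   conjunct i != j removes the loop that would appear when m = 1.             *)
Definition cycle_adj (m : nat) : rel 'I_m :=
  fun i j => (i != j) && ((j == ordS i) || (i == ordS j)).

Lemma cycle_adj_sym m : symmetric (@cycle_adj m).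
Proof. by move=> i j; rewrite /cycle_adj eq_sym orbC. Qed.

Lemma cycle_adj_irrefl m : irreflexive (@cycle_adj m).
Proof. by move=> i; rewrite /cycle_adj eqxx. Qed.

Definition cycle_graph (m : nat) : sgraph :=
  SGraph (@cycle_adj_sym m) (@cycle_adj_irrefl m).

Section CartesianProduct.
Variables G H : sgraph.

Definition box_adj : rel (vert G * vert H) :=
  fun x y => adj x.1 y.1 && (x.2 == y.2) || (x.1 == y.1) && adj x.2 y.2.

Lemma box_adj_sym : symmetric box_adj.
Proof.
move=> x y; rewrite /box_adj adj_sym eq_sym.
by rewrite [x.1 == _]eq_sym [adj x.2 _]adj_sym.
Qed.

Lemma box_adj_irrefl : irreflexive box_adj.
Proof. by move=> x; rewrite /box_adj !adj_irrefl andbF. Qed.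

Definition box_product : sgraph := SGraph box_adj_sym box_adj_irrefl.

End CartesianProduct.

(* Main.v *)
(** Lower bound. Let u be a vertex of a d-regular graph with a star
    edge-coloring in q colors. If v and x are distinct neighbors of u and the
    color of ux also occurs at v, then the color of uv does not occur at x:
    otherwise some walk through x, u, v would alternate. Counting the pairs
    (v, x) of neighbors of u such that the color of uv is missing at x, first by
    v and then by x, gives [3 d <= 2 q + 1], hence [q >= 6] for [d = 4].

    Upper bound. The rows of the torus are of six types, horizontally of period
    4. Rows of types 0, 1, 2, 3 repeated cyclically, followed by one pair of
    rows of types 4, 5 if the height is not a multiple of 4, give every even
    height from 4 on. A walk of four edges stays within two edges of its middle
    vertex, so that only finitely many local configurations have to be
    inspected. *)

Require Import Defs.
From mathcomp Require Import all_boot zmodp zify.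

Set Implicit Arguments.
Unset Strict Implicit.
Unset Printing Implicit Defensive.

Lemma eq_set2 (T : finType) (u v x y : T) : [set u; v] = [set x; y] ->
  (x = u /\ y = v) \/ (x = v /\ y = u).
Proof.
move=> eq_s; have /set2P xuv : x \in [set u; v] by rewrite eq_s set21.
have /set2P yuv : y \in [set u; v] by rewrite eq_s set22.
have /set2P uxy : u \in [set x; y] by rewrite -eq_s set21.
have /set2P vxy : v \in [set x; y] by rewrite -eq_s set22.
by case: xuv; case: yuv; case: uxy; case: vxy => *; subst; auto.
Qed.

Lemma size_undup_proper4 (T : eqType) (a b a' b' : T) :
    a != b -> b != a' -> a' != b' ->
  (size (undup [:: a; b; a'; b']) == 2) = (a == a') && (b == b').
Proof.
move=> ab ba' ab' /=; rewrite !inE (negPf ab) (negPf ba') (negPf ab') /=.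
have [eq_a|] := eqVneq a a'; have [eq_b|] := eqVneq b b' => //=.
  by rewrite -eq_b (negPf ab).
by case: (a == b').
Qed.

Lemma double_count (I J : finType) (A : {set I}) (B : {set J})
    (R : I -> J -> bool) :
  \sum_(i in A) #|[set j in B | R i j]| = \sum_(j in B) #|[set i in A | R i j]|.
Proof.
have cardE (K : finType) (D : {set K}) (P : pred K) :
    #|[set k in D | P k]| = \sum_(k in D) P k.
  by rewrite -sum1_card -big_mkcondr; apply: eq_bigl => k; rewrite !inE.
under eq_bigr do rewrite cardE.
by rewrite exchange_big; apply: eq_bigr => j _; rewrite cardE.
Qed.

Section Edges.
Variable G : sgraph.
Implicit Types u v w : vert G.

Definition neighbors v : {set vert G} := [set w | adj v w].

Lemma adj_neq u v : adj u v -> u != v.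
Proof. by apply: contraTneq => ->; rewrite adj_irrefl. Qed.

Definition adj_edge u v (uv : adj u v) : edge G :=
  exist (fun e => e \in edge_set G) _ (edge_setP uv).

Lemma edge_endsP (e : edge G) :
  exists p : vert G * vert G, adj p.1 p.2 && (val e == [set p.1; p.2]).
Proof.
case: e => A /= /imset2P[u v _]; rewrite inE => uv ->.
by exists (u, v); rewrite uv eqxx.
Qed.

Definition edge_ends (e : edge G) : vert G * vert G := xchoose (edge_endsP e).

Lemma mem_edge (e : edge G) v : v \in val e ->
  exists2 w, adj v w & val e = [set v; w].
Proof.
have [[x y] /andP[/= xy /eqP ->]] := edge_endsP e.
case/set2P=> ->; first by exists y.
by exists x; rewrite 1?adj_sym // setUC.
Qed.

End Edges.

Section WalkColoring.
Variables (G : sgraph) (T : eqType) (f : vert G -> vert G -> T).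

Definition edge_symmetric : Prop := forall u v, adj u v -> f u v = f v u.

Definition proper_walks : Prop := forall x y z,
  adj x y -> adj y z -> x != z -> f x y != f y z.

Definition star_walks : Prop := forall x y z t w,
  adj x y -> adj y z -> adj z t -> adj t w -> x != z -> y != t -> z != w ->
  ~~ ((f x y == f z t) && (f y z == f t w)).

Definition star_walk_coloring : Prop :=
  [/\ edge_symmetric, proper_walks & star_walks].

Hypotheses (f_sym : edge_symmetric) (f_proper : proper_walks).

Lemma proper_walks_inj v : {in neighbors v &, injective (f v)}.
Proof.
move=> x y; rewrite !inE => vx vy eq_f; apply: contraTeq (eqxx (f x v)) => xy.
by rewrite -{2}f_sym // eq_f f_proper // adj_sym.
Qed.

Lemma repeated_color_neq x y z t :
  adj x y -> adj y z -> adj z t -> f x y = f z t -> x != t.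
Proof.
move=> xy yz zt eq_f; apply: contraTneq (adj_neq yz) => eq_xt; subst t.
rewrite negbK; apply/eqP/(@proper_walks_inj x); rewrite ?inE // 1?adj_sym //.
by rewrite eq_f f_sym.
Qed.

End WalkColoring.

Section WalksOfEdgeColoring.
Variables (G : sgraph) (C : finType) (c : edge G -> C).
Variable f : vert G -> vert G -> C.
Hypothesis fE : forall u v (uv : adj u v), f u v = c (adj_edge uv).

Lemma edge_color_sym : edge_symmetric f.
Proof.
move=> u v uv; have vu : adj v u by rewrite adj_sym.
by rewrite !fE; congr c; apply: val_inj; rewrite /= setUC.
Qed.

Lemma proper_edge_coloringP : reflect (proper_walks f) (proper_edge_coloring c).
Proof.
apply: (iffP forallP) => [pc x y z xy yz xz | pf e].
  rewrite !fE; apply: (implyP (forallP (pc _) _)); apply/andP; split.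
    by apply: contraNneq xz => /(congr1 val)/eq_set2[] [? ?]; subst.
  by apply/pred0Pn; exists y; rewrite /= !inE eqxx ?orbT.
apply/forallP=> e'; apply/implyP=> /andP[nee'] /pred0Pn[v /andP[/= ve ve']].
have [u vu def_e] := mem_edge ve; have [w vw def_e'] := mem_edge ve'.
have -> : e = adj_edge vu by apply: val_inj.
have -> : e' = adj_edge vw by apply: val_inj.
rewrite -!fE edge_color_sym //; apply: pf; rewrite // 1?adj_sym //.
by apply: contraNneq nee' => uw; apply/eqP/val_inj; rewrite def_e def_e' uw.
Qed.

Lemma mem_path_colors x p : path (@adj G) x p ->
  [set c e | e in [set e : edge G | val e \in path_edges x p]] =i pairmap f x p.
Proof.
elim: p x => [x _ | y p IHp x /= /andP[xy yp]] a.
  by rewrite in_nil; apply/imsetP => -[e]; rewrite inE.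
have -> : [set e : edge G | val e \in [set x; y] :: path_edges y p] =
    adj_edge xy |: [set e | val e \in path_edges y p].
  by apply/setP=> e; rewrite !inE.
by rewrite imsetU1 in_setU1 in_cons IHp // fE.
Qed.

Lemma bichromatic_path x p : path (@adj G) x p ->
  bichromatic c (path_edges x p) = (size (undup (pairmap f x p)) == 2).
Proof.
move=> xp; rewrite /bichromatic -(card_uniqP (undup_uniq _)); congr (_ == 2).
by apply: eq_card => a; rewrite mem_undup mem_path_colors.
Qed.

Lemma bichromatic_path4 x y z t w : proper_walks f ->
    path (@adj G) x [:: y; z; t; w] -> x != z -> y != t -> z != w ->
  bichromatic c (path_edges x [:: y; z; t; w]) =
    (f x y == f z t) && (f y z == f t w).
Proof.
move=> pf xw xz yt zw; rewrite bichromatic_path //.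
by case/and5P: xw => xy yz zt tw _; apply: size_undup_proper4; apply: pf.
Qed.

Lemma star_edge_to_walk_coloring : star_edge_coloring c -> star_walk_coloring f.
Proof.
case/and3P=> /proper_edge_coloringP pf /forallP no_path /forallP no_cycle.
split=> // [|x y z t w xy yz zt tw xz yt zw]; first exact: edge_color_sym.
apply/negP => bi; have /andP[/eqP eq_f1 /eqP eq_f2] := bi.
have xt := repeated_color_neq edge_color_sym pf xy yz zt eq_f1.
have yw := repeated_color_neq edge_color_sym pf yz zt tw eq_f2.
have xw : path (@adj G) x [:: y; z; t; w] by rewrite /= xy yz zt tw.
rewrite -(bichromatic_path4 pf xw) // in bi; apply: negP bi.
have [eq_xw | neq_xw] := eqVneq x w.
  rewrite -eq_xw in xw *; apply: (implyP (no_cycle [tuple x; y; z; t])).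
  apply/andP; split; first exact: xw.
  by rewrite /= !inE !negb_or xz xt yt !adj_neq.
apply: (implyP (forallP (no_path x) [tuple y; z; t; w])).
apply/andP; split; first exact: xw.
by rewrite /= !inE !negb_or xz xt neq_xw yt yw zw !adj_neq.
Qed.

Lemma star_walk_to_edge_coloring : star_walk_coloring f -> star_edge_coloring c.
Proof.
case=> _ pf sf; apply/and3P; split; first exact/proper_edge_coloringP.
  apply/forallP=> x; apply/forallP=> -[[|y [|z [|t [|w []]]]] //= _].
  apply/implyP=> /andP[xw]; rewrite !inE !negb_or.
  case/and5P=> /and4P[_ xz _ _] /and3P[_ yt _] /andP[_ zw] _ _.
  by rewrite bichromatic_path4 //; case/and5P: xw => *; apply: sf.
apply/forallP=> -[[|x [|y [|z [|t []]]]] //= _].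
apply/implyP=> /andP[xx]; rewrite !inE !negb_or.
case/and4P=> /and3P[_ xz _] /andP[_ yt] _ _.
by rewrite bichromatic_path4 1?[z == x]eq_sym //;
  case/and5P: xx => *; apply: sf; rewrite // eq_sym.
Qed.

End WalksOfEdgeColoring.

Lemma star_edge_colorable_of_walks G q (f : vert G -> vert G -> 'I_q) :
  star_walk_coloring f -> star_edge_colorable G q.
Proof.
move=> f_star; have [f_sym _ _] := f_star.
apply/existsP; exists [ffun e => f (edge_ends e).1 (edge_ends e).2].
apply: (star_walk_to_edge_coloring (f := f)) => // u v uv; rewrite ffunE.
have /andP[_ /eqP/eq_set2[] [-> ->]] := xchooseP (edge_endsP (adj_edge uv)).
  by [].
exact: f_sym.
Qed.

Lemma star_edge_colorable_walks G q (u v : vert G) : adj u v ->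
  star_edge_colorable G q ->
  exists f : vert G -> vert G -> 'I_q, star_walk_coloring f.
Proof.
move=> uv /existsP[c c_star].
exists (fun x y => oapp c (c (adj_edge uv)) (insub [set x; y])).
apply: star_edge_to_walk_coloring c_star => x y xy.
by rewrite -[[set x; y]]/(val (adj_edge xy)) valK.
Qed.

Section ColorsAtVertex.
Variables (G : sgraph) (C : finType) (f : vert G -> vert G -> C) (d : nat).
Hypothesis f_star : star_walk_coloring f.
Hypothesis G_regular : forall v : vert G, #|neighbors v| = d.
Implicit Types u v x : vert G.

Definition palette v : {set C} := f v @: neighbors v.

Let f_inj v : {in neighbors v &, injective (f v)}.
Proof. by have [f_sym f_proper _] := f_star; apply: proper_walks_inj. Qed.

Definition color_missing u v x : bool := f u v \notin palette x.

Lemma card_palette v : #|palette v| = d.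
Proof. by rewrite card_in_imset ?G_regular //; apply: f_inj. Qed.

Lemma shared_color_missing u v x : adj u v -> adj u x -> x != v ->
  f u x \in palette v -> color_missing u v x.
Proof.
have [f_sym _ f_alt] := f_star => uv ux xv /imsetP[y]; rewrite inE => vy eq_y.
apply/imsetP=> -[z]; rewrite inE => xz eq_z.
have neq_f : f u x != f u v.
  by apply: contraNneq xv => eq_f; apply/eqP/(@f_inj u); rewrite ?inE.
have zu : z != u.
  by apply: contraNneq neq_f => zu; rewrite eq_z zu f_sym.
have uy : u != y.
  by apply: contraNneq neq_f => uy; rewrite eq_y -uy f_sym // adj_sym.
have zx : adj z x by rewrite adj_sym.
have xu : adj x u by rewrite adj_sym.
have := f_alt z x u v y zx xu uv vy zu xv uy.
by rewrite (f_sym _ _ zx) (f_sym _ _ xu) -eq_z eq_y !eqxx.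
Qed.

Lemma card_missing_ge u v : adj u v ->
  2 * d <= #|[set x in neighbors u | color_missing u v x]| + #|C|.+1.
Proof.
move=> uv; set M := [set x in _ | _].
have shared_sub : palette u :&: palette v \subset f u v |: f u @: M.
  apply/subsetP=> a /setIP[/imsetP[x ux ->] shared]; rewrite in_setU1.
  have [-> | xv] := eqVneq x v; first by rewrite eqxx.
  by rewrite imset_f ?orbT // inE ux (shared_color_missing uv) // -in_set.
have shared_le : #|palette u :&: palette v| <= #|M|.+1.
  apply: leq_trans (subset_leq_card shared_sub) _.
  by rewrite cardsU1 -add1n leq_add ?leq_b1 ?leq_imset_card.
have := cardsUI (palette u) (palette v); rewrite !card_palette.
have := subset_leq_card (subsetT (palette u :|: palette v)); rewrite cardsT.
by lia.
Qed.

Lemma card_missing_le u x :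
  #|[set v in neighbors u | color_missing u v x]| + d <= #|C|.
Proof.
rewrite -(card_in_imset (f := f u)); last first.
  by move=> v w /setIdP[uv _] /setIdP[uw _]; apply: f_inj.
rewrite -(card_palette x) -(cardsC (palette x)) addnC leq_add2l.
by apply/subset_leq_card/subsetP=> a /imsetP[v /setIdP[_ av] ->]; rewrite inE.
Qed.

Lemma star_walk_coloring_regular u : 0 < d -> 3 * d <= (2 * #|C|).+1.
Proof.
move=> d_gt0.
pose total :=
  \sum_(v in neighbors u) #|[set x in neighbors u | color_missing u v x]|.
have const_sum j : d * j = \sum_(v in neighbors u) j.
  by rewrite sum_nat_const G_regular.
have total_ge : d * (2 * d) <= total + d * #|C|.+1.
  rewrite !const_sum -big_split; apply: leq_sum => v; rewrite inE.
  exact: card_missing_ge.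
have total_le : total + d * d <= d * #|C|.
  rewrite /total double_count !const_sum -big_split; apply: leq_sum => x _.
  exact: card_missing_le.
by rewrite -(leq_pmul2l d_gt0); nia.
Qed.

End ColorsAtVertex.

Theorem star_edge_colorable_regular G d q (u : vert G) :
    (forall v : vert G, #|neighbors v| = d) -> star_edge_colorable G q ->
  3 * d <= (2 * q).+1.
Proof.
move=> G_regular colG; have [-> // | d_gt0] := posnP d.
have [v uv] : exists v, v \in neighbors u.
  by apply/set0Pn; rewrite -card_gt0 G_regular.
rewrite inE in uv; have [f f_star] := star_edge_colorable_walks uv colG.
have := star_walk_coloring_regular f_star G_regular u d_gt0.
by rewrite card_ord.
Qed.

Record directions (G : sgraph) (D : finType) := Directions {
  step : vert G -> D -> vert G;
  opp : D -> D;
  adj_stepP : forall u v, reflect (exists d, v = step u d) (adj u v);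
  step_inj : forall u, injective (step u);
  step_opp : forall u d, step (step u d) (opp d) = u }.

Section StarAt.
Variables (D C : eqType) (opp : D -> D) (near : D -> C) (far : D -> D -> C).

(* [near] colors the edges at a vertex and [far d] those at its neighbor in
   direction [d]: no walk of four edges alternates with this middle vertex. *)
Definition star_at : Prop :=
  injective near /\
  forall d d' e e', d != e -> d' != opp d -> e' != opp e ->
    ~~ ((far d d' == near e) && (near d == far e e')).

Definition star_atb (ds : seq D) : bool :=
  all2rel (fun d e => (d != e) ==> (near d != near e) &&
    allrel (fun d' e' => (d' != opp d) && (e' != opp e) ==>
      ~~ ((far d d' == near e) && (near d == far e e'))) ds ds) ds.

Lemma star_atP ds : (forall d, d \in ds) -> reflect star_at (star_atb ds).
Proof.
move=> mem_ds; apply: (iffP allrelP) => [ok | [near_inj far_star] d e _ _].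
  split=> [d e eq_near | d d' e e' de dd' ee'].
    apply: contraTeq (ok d e (mem_ds d) (mem_ds e)) => de.
    by rewrite de eq_near eqxx.
  have := ok d e (mem_ds d) (mem_ds e); rewrite de.
  by case/andP=> _ /allrelP/(_ d' e' (mem_ds d') (mem_ds e')); rewrite dd' ee'.
apply/implyP=> de; rewrite (inj_eq near_inj) de; apply/allrelP=> d' e' _ _.
by apply/implyP=> /andP[]; apply: far_star.
Qed.

End StarAt.

Section Directions.
Variables (G : sgraph) (D : finType) (L : directions G D).
Implicit Types u v : vert G.

Lemma directions_regular u : #|neighbors u| = #|D|.
Proof.
transitivity #|[set step L u d | d in [set: D]]|.
  congr #|pred_of_set _|; apply/setP=> v; rewrite inE.
  apply/adj_stepP/imsetP=> [[d ->] | [d _ ->]]; last by exists d.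
  by exists d; rewrite ?inE.
by rewrite card_imset ?cardsT //; apply: step_inj.
Qed.

Lemma directions_star_colorable q (col : vert G -> D -> 'I_q) (d0 : D) :
    (forall u d, col (step L u d) (opp L d) = col u d) ->
    (forall u, star_at (opp L) (col u) (fun d => col (step L u d))) ->
  star_edge_colorable G q.
Proof.
move=> col_opp col_star.
pose f u v := col u (odflt d0 [pick d | v == step L u d]).
have fE u d : f u (step L u d) = col u d.
  rewrite /f; case: pickP => [e /eqP/step_inj -> // | /(_ d)].
  by rewrite eqxx.
have fE_opp u d : f (step L u d) u = col u d.
  by rewrite -{2}(step_opp L u d) fE col_opp.
have neq_opp u d d' : u != step L (step L u d) d' -> d' != opp L d.
  by apply: contraNneq => ->; rewrite step_opp.
apply: (@star_edge_colorable_of_walks G q f); split.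
- by move=> u v /(adj_stepP L)[d ->]; rewrite fE fE_opp.
- move=> x y z; rewrite adj_sym => /(adj_stepP L)[d ->] /(adj_stepP L)[e ->] ne.
  rewrite fE_opp fE (inj_eq (proj1 (col_star y))).
  by apply: contraNneq ne => ->.
move=> x y z t w xy yz /(adj_stepP L)[e ->] /(adj_stepP L)[e' ->].
rewrite adj_sym in yz; case/(adj_stepP L): yz xy => d ->.
rewrite adj_sym => /(adj_stepP L)[d' ->] xz yt zw.
rewrite !fE !fE_opp; apply: (proj2 (col_star z)).
- by apply: contraNneq yt => ->.
- by rewrite eq_sym in xz; apply: neq_opp xz.
- exact: neq_opp zw.
Qed.

End Directions.

Lemma ordS_neq m (i : 'I_m) : 1 < m -> i != ordS i.
Proof.
case: i => i lt_im m_gt1; rewrite -val_eqE /=.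
have [eq_m | ne_m] := eqVneq i.+1 m; first by rewrite eq_m modnn; lia.
by rewrite modn_small; lia.
Qed.

Lemma ordS_ordS_neq m (i : 'I_m) : 2 < m -> ordS (ordS i) != i.
Proof.
case: i => i lt_im m_gt2; rewrite -val_eqE /= -addn1 modnDml addn1.
have [le_m | lt_m] := leqP m i.+2; last by rewrite modn_small; lia.
by rewrite -(subnK le_m) modnDr modn_small; lia.
Qed.

Section CycleDirections.
Variable m : nat.
Hypothesis m_gt2 : 2 < m.

Definition cycle_step (i : 'I_m) (forward : bool) : 'I_m :=
  if forward then ordS i else ord_pred i.

Lemma cycle_step_negb i b : cycle_step (cycle_step i b) (~~ b) = i.
Proof. by case: b => /=; rewrite ?ordSK ?ord_predK. Qed.

Lemma cycle_step_inj i : injective (cycle_step i).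
Proof.
have /eqP neq_i : ordS i != ord_pred i.
  by rewrite -{1}[i]ord_predK ordS_ordS_neq.
by move=> [] [] //= /esym.
Qed.

Lemma cycle_adj_stepP (i j : 'I_m) :
  reflect (exists b, j = cycle_step i b) (@adj (cycle_graph m) i j).
Proof.
apply: (iffP andP) => [[_ /orP[] /eqP ->] | [[] ->]] /=.
- by exists true.
- by exists false; rewrite /= ordSK.
- by rewrite ordS_neq ?eqxx // ltnW.
- by rewrite ord_predK eqxx orbT -{1}[i]ord_predK eq_sym ordS_neq // ltnW.
Qed.

Definition cycle_directions : directions (cycle_graph m) bool :=
  @Directions (cycle_graph m) bool cycle_step negb cycle_adj_stepP
    cycle_step_inj cycle_step_negb.

End CycleDirections.

Definition sum_opp (D E : Type) (oppD : D -> D) (oppE : E -> E) (d : D + E) :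
    D + E :=
  match d with inl a => inl (oppD a) | inr b => inr (oppE b) end.

Section BoxDirections.
Variables (G H : sgraph) (D E : finType).
Variables (L : directions G D) (M : directions H E).
Local Notation GH := (box_product G H).

Definition box_step (u : vert GH) (d : D + E) : vert GH :=
  match d with
  | inl a => (step L u.1 a, u.2)
  | inr b => (u.1, step M u.2 b)
  end.

Lemma box_adj_stepP (u v : vert GH) :
  reflect (exists d, v = box_step u d) (adj u v).
Proof.
case: u v => [x y] [x' y']; rewrite /= /box_adj /=.
apply: (iffP orP) => [[] | [[a|b] /= [-> ->]]].
- by case/andP=> /(adj_stepP L)[a ->] /eqP ->; exists (inl a).
- by case/andP=> /eqP -> /(adj_stepP M)[b ->]; exists (inr b).
- by left; rewrite eqxx andbT; apply/(adj_stepP L); exists a.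
- by right; rewrite eqxx; apply/(adj_stepP M); exists b.
Qed.

Lemma box_step_inj (u : vert GH) : injective (box_step u).
Proof.
have neq_step (K : sgraph) (B : finType) (N : directions K B) x b :
    step N x b <> x.
  move=> eq_x; apply: (negP (negbT (adj_irrefl x))).
  by rewrite -{2}eq_x; apply/(adj_stepP N); exists b.
move=> [a|b] [a'|b'] [] => [/step_inj -> | /neq_step | /esym/neq_step |] //.
by move/step_inj->.
Qed.

Lemma box_step_opp (u : vert GH) d :
  box_step (box_step u d) (sum_opp (opp L) (opp M) d) = u.
Proof. by case: u d => x y [a|b]; rewrite /= step_opp. Qed.

Definition box_directions : directions GH (D + E)%type :=
  @Directions GH (D + E)%type box_step (sum_opp (opp L) (opp M)) box_adj_stepP
    box_step_inj box_step_opp.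

End BoxDirections.

Definition torus (m n : nat) : sgraph :=
  box_product (cycle_graph m) (cycle_graph n).

Lemma torus_regular m n (u : vert (torus m n)) :
  2 < m -> 2 < n -> #|neighbors u| = 4.
Proof.
move=> m_gt2 n_gt2; pose L := cycle_directions m_gt2.
rewrite (directions_regular (box_directions L (cycle_directions n_gt2))).
by rewrite card_sum card_bool.
Qed.

Definition torus_dir : finType := (bool + bool)%type.

Definition torus_opp : torus_dir -> torus_dir := sum_opp negb negb.

(* An explicit list, because [enum] does not reduce under [vm_compute]. *)
Definition torus_dirs : seq torus_dir :=
  [:: inl true; inl false; inr true; inr false].

Lemma mem_torus_dirs d : d \in torus_dirs.
Proof. by case: d => [[] | []]. Qed.

(* Horizontal edges have the colors 0 to 3 of [lshift]; so have the vertical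
   edges above a row of even type, while the other vertical edges alternate
   between the colors 4 and 5 of [rshift]. The two shift tables were found by
   computer search. *)
Definition right_color (x : 'I_4) (r : nat) : 'I_6 :=
  lshift 2 (inZp (x + nth 0 [:: 0; 1; 2; 3; 0; 3] r) : 'I_4).

Definition up_color (x : 'I_4) (r : nat) : 'I_6 :=
  let s := x + nth 0 [:: 2; 0; 0; 1; 1; 1] r in
  if odd r then rshift 4 (inZp s : 'I_2) else lshift 2 (inZp s : 'I_4).

Definition rows_above (r : nat) : seq nat :=
  nth [::] [:: [:: 1]; [:: 2]; [:: 3]; [:: 0; 4]; [:: 5]; [:: 0]] r.

(* Colors at a vertex in a column of class [x], in a row of type [r] above a row
   of type [r']. *)
Definition near_color (x : 'I_4) (r' r : nat) (d : torus_dir) : 'I_6 :=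
  match d with
  | inl true => right_color x r
  | inl false => right_color (ord_pred x) r
  | inr true => up_color x r
  | inr false => up_color x r'
  end.

(* Colors at the neighbors of a vertex in a row of type [r2], when the rows
   around it are of types [r0], [r1], [r2], [r3] from bottom to top. *)
Definition far_color (x : 'I_4) (r0 r1 r2 r3 : nat) (d : torus_dir) :
    torus_dir -> 'I_6 :=
  match d with
  | inl b => near_color (cycle_step x b) r1 r2
  | inr true => near_color x r2 r3
  | inr false => near_color x r0 r1
  end.

Lemma star_at_rows_check :
  all (fun x => all (fun r0 => all (fun r1 => all (fun r2 => all (fun r3 =>
    star_atb torus_opp (near_color (inZp x) r1 r2)
      (far_color (inZp x) r0 r1 r2 r3) torus_dirs)
  (rows_above r2)) (rows_above r1)) (rows_above r0)) (iota 0 6)) (iota 0 4).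
Proof. by vm_compute. Qed.

Lemma star_at_rows x r0 r1 r2 r3 :
    r1 \in rows_above r0 -> r2 \in rows_above r1 -> r3 \in rows_above r2 ->
  star_at torus_opp (near_color x r1 r2) (far_color x r0 r1 r2 r3).
Proof.
move=> r01 r12 r23; apply/(star_atP _ _ _ mem_torus_dirs); rewrite -(valZpK x).
have r0_lt6 : r0 \in iota 0 6.
  rewrite mem_iota ltnNge; apply: contraL r01 => r0_ge6.
  by rewrite /rows_above nth_default.
have x_lt4 : val x \in iota 0 4 by rewrite mem_iota ltn_ord.
have /allP/(_ _ x_lt4)/allP/(_ _ r0_lt6)/allP/(_ _ r01) := star_at_rows_check.
by move/allP/(_ _ r12)/allP/(_ _ r23).
Qed.

Section TorusColoring.
Variables (m n : nat) (row_type : 'I_n -> nat).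
Hypotheses (m_gt2 : 2 < m) (n_gt2 : 2 < n) (dvd4m : 4 %| m).
Hypothesis row_typeS : forall j, row_type (ordS j) \in rows_above (row_type j).

Definition column_class (i : 'I_m) : 'I_4 := inZp i.

Lemma column_class_step i b :
  column_class (cycle_step i b) = cycle_step (column_class i) b.
Proof.
have classS j : column_class (ordS j) = ordS (column_class j).
  by apply: val_inj; rewrite /= modn_dvdm // -addn1 -modnDml addn1.
case: b => //=; apply: (@ordS_inj 4).
by rewrite -classS !ord_predK.
Qed.

Definition torus_color (u : vert (torus m n)) (d : torus_dir) : 'I_6 :=
  near_color (column_class u.1) (row_type (ord_pred u.2)) (row_type u.2) d.

Let L : directions (torus m n) torus_dir :=
  box_directions (cycle_directions m_gt2) (cycle_directions n_gt2).

Lemma torus_color_step u d : torus_color (step L u d) =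
  far_color (column_class u.1) (row_type (ord_pred (ord_pred u.2)))
    (row_type (ord_pred u.2)) (row_type u.2) (row_type (ordS u.2)) d.
Proof.
case: u d => i j [b|[]] //; rewrite /torus_color /= ?ordSK //.
by rewrite column_class_step.
Qed.

Lemma torus_color_opp u d :
  torus_color (step L u d) (opp L d) = torus_color u d.
Proof. by rewrite torus_color_step; case: d => [[]|[]] /=; rewrite ?ordSK. Qed.

Lemma torus_rows_colorable : star_edge_colorable (torus m n) 6.
Proof.
apply: (directions_star_colorable (inl true) torus_color_opp) => u.
have r01 := row_typeS (ord_pred (ord_pred u.2)).
have r12 := row_typeS (ord_pred u.2); rewrite !ord_predK in r01 r12.
have [near_inj far_star] :=
  star_at_rows (column_class u.1) r01 r12 (row_typeS u.2).
by split=> // d d' e e'; rewrite !torus_color_step; apply: far_star.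
Qed.

End TorusColoring.

Definition even_row_type (n j : nat) : nat :=
  if j < 4 * (n %/ 4) then j %% 4 else 4 + j %% 4.

Lemma even_row_type_above n (j : 'I_n) : ~~ odd n -> 2 < n ->
  even_row_type n (ordS j) \in rows_above (even_row_type n j).
Proof.
case: j => j lt_jn n_even n_gt2 /=; rewrite /even_row_type.
have [eq_n | neq_n] := eqVneq j.+1 n.
  rewrite eq_n modnn; case: ifP => j_lt; case: ifP => n_ge; try lia.
    by have -> : j %% 4 = 3 by lia.
  by have -> : j %% 4 = 1 by lia.
rewrite modn_small; last by lia.
case: ifP => Sj_lt; case: ifP => j_lt; try lia.
- have : j %% 4 < 4 by rewrite ltn_pmod.
  have -> : j.+1 %% 4 = (j %% 4).+1 %% 4 by lia.
  by case: (j %% 4) => [|[|[|[|]]]].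
- have -> : j %% 4 = 3 by lia.
  by have -> : j.+1 %% 4 = 0 by lia.
have -> : j %% 4 = 0 by lia.
by have -> : j.+1 %% 4 = 1 by lia.
Qed.

Lemma torus_star_6_colorable m n : 4 %| m -> 2 < m -> ~~ odd n -> 2 < n ->
  star_edge_colorable (torus m n) 6.
Proof.
move=> dvd4m m_gt2 n_even n_gt2.
apply: (@torus_rows_colorable m n (even_row_type n)) => // j.
exact: even_row_type_above.
Qed.

Theorem theorem13 (k l : nat) (hk : 1 <= k) (hl : 2 <= l) :
  star_chromatic_index
    (box_product (cycle_graph (4 * k)) (cycle_graph (2 * l))) = 6.
Proof.
have m_gt2 : 2 < 4 * k by lia.
have n_gt2 : 2 < 2 * l by lia.
rewrite /star_chromatic_index; case: ex_minnP => q q_colorable q_min.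
apply/eqP; rewrite eqn_leq q_min /=; last first.
  by apply: torus_star_6_colorable; rewrite ?dvdn_mulr ?oddM.
have u : vert (torus (4 * k) (2 * l)).
  exact: (Ordinal (ltnW (ltnW m_gt2)), Ordinal (ltnW (ltnW n_gt2))).
have regular v := torus_regular v m_gt2 n_gt2.
by have := star_edge_colorable_regular u regular q_colorable; lia.
Qed.
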